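(* Fix an integer $N\ge1$, real numbers $\kappa,m,t_0>0$, and vectors $\mathcal V=(\nu_i)$, $\Omega^0=(\omega_i^0)$, $\Theta^*(t_0)=(\theta_1^*(t_0),\dots,\theta_N^*(t_0))\in\mathbb{R}^N$. Define $\mathcal F=(f_1,\dots,f_N):(C[0,t_0])^N\to(C[0,t_0])^N$ by setting, for $\Omega^*=(\omega_1^*,\dots,\omega_N^* )\in(C[0,t_0])^N$ and $t\in[0,t_0]$, $$f_i(\Omega^* )(t)=\omega_i^0e^{-t/m}+\nu_i(1-e^{-t/m})+\frac{\kappa}{Nm}\sum_{l=1}^N\int_0^te^{-(t-\sigma)/m}\sin\left(\theta_l^*(t_0)-\theta_i^*(t_0)-\int_\sigma^{t_0}(\omega_l^*(\tau)-\omega_i^*(\tau))\,d\tau\right)d\sigma.$$ Then the following hold. (1) Given $\Omega^*\in(C[0,t_0])^N$, there exists a (necessarily unique) solution $(\Theta,\Omega)$ of the inertial Kuramoto system (see context), for some choice of initial phase data $\Theta^0$, with $\Theta(t_0)=\Theta^*(t_0)$, $\Omega(0)=\Omega^0$ and $\Omega(t)=\Omega^*(t)$ for $t\in[0,t_0]$, if and only if $\mathcal F(\Omega^* )=\Omega^*$. (2) With respect to the norm $\|\Omega^*\|=\max_{1\le i\le N}\sup_{t\in[0,t_0]}|\omega_i^*(t)|$ on $(C[0,t_0])^N$, the map $\mathcal F$ is Lipschitz with constant $\min\left\{2\kappa t_0,\frac{\kappa t_0^2}{m}\right\}$. (3) If $t_0<\max\left\{\frac1{2\kappa},\sqrt{\frac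 m\kappa}\right\}$, then there exists a unique solution $(\Theta,\Omega)$ of the inertial Kuramoto system with $\Theta(t_0)=\Theta^*(t_0)$ and $\Omega(0)=\Omega^0$, and it can be found by iterating $\mathcal F$: for any $\Omega^*\in(C[0,t_0])^N$, on $[0,t_0]$ one has $$\Omega=\lim_{n\to\infty}\mathcal F^n(\Omega^* ),\qquad \Theta(t)=\Theta^*(t_0)-\int_t^{t_0}\Omega(\tau)\,d\tau,\quad t\in[0,t_0],$$ and, setting $\Theta^0:=\Theta(0)$, $(\Theta,\Omega)$ is the solution of the inertial Kuramoto system with initial data $(\Theta^0,\Omega^0)$.
   Context: The inertial Kuramoto system (with inertia $m$, coupling strength $\kappa$, natural frequencies $\mathcal V$), for $\Theta=(\theta_i)$, $\Omega=(\omega_i):[0,\infty)\to\mathbb{R}^N$, is $$\dot\theta_i=\omega_i,\qquad \dot\omega_i=\frac1m\left(\nu_i-\omega_i+\frac\kappa N\sum_{j=1}^N\sin(\theta_j-\theta_i)\right),\qquad i=1,\dots,N,$$ with initial data $(\Theta,\Omega)(0)=(\Theta^0,\Omega^0)$; it has a unique global solution for every initial data. $C[0,t_0]$ is the space of continuous real functions on $[0,t_0]$. The limit in (3) is in the norm of (2). *)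

(* Defs.v *)
From HB Require Import structures.
From mathcomp Require Import all_boot all_order all_algebra.
From mathcomp Require Import all_classical all_reals all_analysis.

Set Implicit Arguments.
Unset Strict Implicit.
Unset Printing Implicit Defensive.

Import Order.TTheory GRing.Theory Num.Theory.
Import numFieldNormedType.Exports.

Local Open Scope classical_set_scope.
Local Open Scope ring_scope.

(* Functions on [0, +oo[ or on [0, t0] are represented by functions R -> R of
   which only the values on that interval are relevant: the predicates below
   never look outside it, and equality of such functions is [agree_on] it. *)

Section InertialKuramoto.
Context {R : realType} {N : nat}.

Definition agree_on (A : set R) (w1 w2 : 'I_N -> R -> R) : Prop :=
  forall i t, A t -> w1 i t = w2 i t.

(* Derivative relative to A; for A = [0, +oo[ this is the usual derivative at
   t > 0 and the right derivative at t = 0. *)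
Definition has_derivative_within (A : set R) (f : R -> R) (t l : R) : Prop :=
  (f s - f t) / (s - t) @[s --> within A t^'] --> l.

Definition inertial_kuramoto (m kappa : R) (nu : 'I_N -> R)
    (Th Om : 'I_N -> R -> R) : Prop :=
  forall i t, 0 <= t ->
    has_derivative_within `[0, +oo[ (Th i) t (Om i t) /\
    has_derivative_within `[0, +oo[ (Om i) t
      (m^-1 * (nu i - Om i t
               + kappa / N%:R * \sum_(j < N) sin (Th j t - Th i t))).

Definition inertial_kuramoto_ivp (m kappa : R) (nu Th0 Om0 : 'I_N -> R)
    (Th Om : 'I_N -> R -> R) : Prop :=
  [/\ inertial_kuramoto m kappa nu Th Om,
      forall i, Th i 0 = Th0 i & forall i, Om i 0 = Om0 i].

(* w belongs to C[0, t0]^N *)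
Definition in_CN (t0 : R) (w : 'I_N -> R -> R) : Prop :=
  forall i, {within `[0, t0], continuous (w i)}.

(* Since the suprema are nonnegative, starting the maximum from 0 is harmless. *)
Definition CN_norm (t0 : R) (w : 'I_N -> R -> R) : R :=
  \big[Num.max/0]_(i < N) sup [set `|w i t| | t in `[0, t0]].

Definition CN_dist (t0 : R) (w1 w2 : 'I_N -> R -> R) : R :=
  CN_norm t0 (fun i t => w1 i t - w2 i t).

(* int_a^b f, for a <= b *)
Definition intR (a b : R) (f : R -> R) : R :=
  \int[@lebesgue_measure R]_(s in `[a, b]) f s.

Definition FF (m kappa t0 : R) (nu Om0 Thstar : 'I_N -> R)
    (w : 'I_N -> R -> R) : 'I_N -> R -> R := fun i t =>
  Om0 i * expR (- t / m) + nu i * (1 - expR (- t / m))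
  + kappa / (N%:R * m) *
    \sum_(l < N) intR 0 t (fun sigma =>
      expR (- (t - sigma) / m) *
      sin (Thstar l - Thstar i
           - intR sigma t0 (fun tau => w l tau - w i tau))).

End InertialKuramoto.

(* Main.v *)
(** Integrating the second equation of the system against e^{t/m}, with the
    phases recovered from Theta^*(t0) and the frequencies w, shows that F(w) is
    the solution of m f' + f = nu + (kappa/N) sum sin(...) driven by the phases
    of w, with f(0) = Omega^0; hence F(w) = w exactly when w is the frequency
    part of a solution on [0, t0].  Such a solution extends to [0, +oo[ because
    the vector field is globally Lipschitz: Picard iteration contracts in the
    norm weighted by e^{-Lt} on the whole half line at once, so that no gluing
    of local solutions is needed, and uniqueness identifies the global solution
    with the given one on [0, t0].  For the Lipschitz bound, two frequency
    vectors at distance D give phases at distance D (t0 - s) at time s, so the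
    difference of the right-hand sides is at most 2 kappa D (t0 - s); this is
    integrated against e^{-(t-s)/m} / m, bounding either t0 - s by t0 or the
    exponential by 1. *)

Require Import Defs.
From HB Require Import structures.
From mathcomp Require Import all_boot all_order all_algebra.
From mathcomp Require Import all_classical all_reals all_analysis.
From mathcomp Require Import ring lra.
Set Implicit Arguments.
Unset Strict Implicit.
Unset Printing Implicit Defensive.
Import Order.TTheory GRing.Theory Num.Theory.
Import numFieldNormedType.Exports.
Local Open Scope classical_set_scope.
Local Open Scope ring_scope.

(** * One-variable calculus *)

Section Calculus.
Context {R : realType}.
Implicit Types (A : set R) (f g P : R -> R) (a b t l : R).

(** Composing with a clamp onto an interval makes a function that is continuous only there
    continuous on the whole line, which the construction of primitives requires. *)
Lemma continuous_retract A f (r : R -> R) :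
  (forall x, A (r x)) -> continuous r -> {within A, continuous f} ->
  continuous (f \o r).
Proof.
move=> Ar cr /subspace_continuousP cf x.
apply: (@cvg_comp _ _ _ r f (nbhs x) (within A (nbhs (r x)))); last exact: cf.
move=> U /= /(cr x); rewrite !nbhs_simpl /=.
by apply: (@filterS _ (nbhs x)) => y /=; apply; exact: Ar.
Qed.

Lemma is_derive_continuous f t l : is_derive t 1 f l -> {for t, continuous f}.
Proof.
by move=> [dft _]; apply: differentiable_continuous; apply/derivable1_diffP.
Qed.

(** Substituting [s = h + t] passes from the library's difference quotient to the slope used in
    [has_derivative_within]. *)
Lemma is_derive_slopeP f t l :
  is_derive t 1 f l <-> (f s - f t) / (s - t) @[s --> t^'] --> l.
Proof.
suff E : (f s - f t) / (s - t) @[s --> t^'] --> l <->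
    h^-1 *: ((f \o shift t) (h *: 1) - f t) @[h --> 0^'] --> l.
  split=> [dfl|/E cfl]; first by apply/E; case: dfl => df <-.
  by apply: DeriveDef; [apply/cvg_ex; exists l | exact/cvg_lim].
have S (h : R) : h^-1 *: ((f \o shift t) (h *: 1) - f t) =
    (f (h + t) - f t) / (h + t - t).
  by rewrite /= addrK [h *: 1]mulr1 mulrC.
split=> /cvgrPdist_lt H; apply/cvgrPdist_lt => e /H {H}; rewrite !near_withinE.
- move=> /nbhs_ballP[d d0 H]; apply/nbhs_ballP; exists d => // h + h0.
  rewrite /ball/= sub0r normrN S => hd; apply: H; last first.
    by rewrite -subr_eq0 addrK.
  by rewrite /ball/= opprD addrCA subrr addr0 normrN.
- move=> /nbhs_ballP[d d0 H]; apply/nbhs_ballP; exists d => // s + st.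
  rewrite /ball/= => hd.
  have := H (s - t); rewrite S subrK; apply; last by rewrite subr_eq0.
  by rewrite /ball/= sub0r normrN distrC.
Qed.

Lemma is_derive_within A f t l :
  is_derive t 1 f l -> has_derivative_within A f t l.
Proof. by move=> /is_derive_slopeP ?; exact: cvg_within_filter. Qed.

Lemma has_derivative_within_is_derive A f t l :
  nbhs t A -> has_derivative_within A f t l -> is_derive t 1 f l.
Proof.
move=> At dft; apply/is_derive_slopeP; apply: cvg_trans dft.
apply: cvg_app => U; rewrite !nbhs_nearE !near_withinE => H.
by near=> s => st; apply: (near H s); last exact: (near At s).
Unshelve. all: by end_near. Qed.

(** Near [t] the slope differs from [l] by less than 1, so the increment of [f] is at most
    [(|l| + 1) * |s - t|]. This covers the endpoint 0 of the half line, where only a one-sided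
    derivative exists. *)
Lemma has_derivative_within_continuous A f t l :
  has_derivative_within A f t l -> f @ within A (nbhs t) --> f t.
Proof.
move=> /cvgrPdist_lt /(_ 1 ltr01) H; apply/cvgrPdist_lt => e e0.
rewrite near_withinE in H.
rewrite near_withinE in H.
rewrite near_withinE.
have l0 : 0 < `|l| + 1 by rewrite ltr_wpDl.
near=> s => As.
have [->|st] := eqVneq s t; first by rewrite subrr normr0.
have sl : `|l - (f s - f t) / (s - t)| < 1 by apply: (near H s).
have sl' : `|(f s - f t) / (s - t)| <= `|l| + 1.
  rewrite -lerBlDl (le_trans (lerB_dist _ _))//.
  by rewrite distrC ltW.
rewrite distrC -(@divfK _ (s - t) _ (f s - f t)) ?subr_eq0// normrM.
apply: (@le_lt_trans _ _ ((`|l| + 1) * `|s - t|)).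
  by rewrite ler_wpM2r.
rewrite mulrC -ltr_pdivlMr// distrC.
near: s; apply: cvgr_dist_lt; [exact: cvg_id|exact: divr_gt0].
Unshelve. all: by end_near. Qed.

Lemma intR_derive a b f P : a <= b -> {within `[a, b], continuous f} ->
  {within `[a, b], continuous P} ->
  (forall x, a < x < b -> is_derive x 1 P (f x)) ->
  intR a b f = P b - P a.
Proof.
rewrite le_eqVlt => /predU1P[<- _ _ _|ab cf /continuous_within_itvP].
  by rewrite /intR set_itv1 Rintegral_set1 subrr.
move=> /(_ ab)[_ Pa Pb] dP.
rewrite /intR /Rintegral (@continuous_FTC2 _ f P a b)//.
- split=> // x; rewrite in_itv/= => /dP dPx; exact: ex_derive.
- by move=> x; rewrite in_itv/= => /dP dPx; rewrite derive1E derive_val.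
Qed.

(* The integral starts at [a - 1] so that the derivative at [a] is two-sided. *)
Lemma exists_primitive a f : continuous f ->
  exists P, forall t, a <= t -> is_derive t 1 P (f t).
Proof.
move=> cf; exists (fun x => intR (a - 1) x f) => t at_.
have tt1 : t < t + 1 by rewrite ltrDl.
have af : (a - 1) < t by rewrite (lt_le_trans _ at_)// ltrBlDr ltrDl.
have fi : (@lebesgue_measure R).-integrable `[a - 1, t + 1] (EFin \o f).
  apply: continuous_compact_integrable; first exact: segment_compact.
  exact: continuous_subspaceT.
have [dP P'] := @continuous_FTC1 _ f (BLeft (a - 1)) t (t + 1) tt1 fi af (cf t).
by apply: DeriveDef; [exact: dP | rewrite -derive1E; exact: P'].
Qed.

(** Mean value theorem for [g - s * f] with [s = 1] and [s = -1], whose derivative is nonnegative.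
    The later estimates compare primitives through this lemma instead of bounding integrals. *)
Lemma norm_increment_le a b f g (f' g' : R -> R) : a <= b ->
  {within `[a, b], continuous f} -> {within `[a, b], continuous g} ->
  (forall x, a < x < b -> is_derive x 1 f (f' x)) ->
  (forall x, a < x < b -> is_derive x 1 g (g' x)) ->
  (forall x, a < x < b -> `|f' x| <= g' x) ->
  `|f b - f a| <= g b - g a.
Proof.
rewrite le_eqVlt => /predU1P[-> *|ab cf cg df dg fg].
  by rewrite !subrr normr0.
suff H (s : R) : `|s| = 1 -> s * (f b - f a) <= g b - g a.
  rewrite ler_norml; apply/andP; split.
    by rewrite lerNl -mulN1r H// normrN1.
  by rewrite -[leLHS]mul1r H// normr1.
move=> s1; rewrite -subr_ge0.
have [||c /[!in_itv]/= cab E] := @MVT _ (fun x => g x - s * f x)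
  (fun x => g' x - s * f' x) a b ab.
- move=> x /[!in_itv]/= xab; have ? := df _ xab; have ? := dg _ xab.
  have -> : (fun x => g x - s * f x) = g - s \*: f by [].
  exact: is_deriveB.
- move=> x; apply: cvgB; first exact: cg.
  by apply: cvgMr; exact: cf.
have -> : g b - g a - s * (f b - f a) = g b - s * f b - (g a - s * f a).
  by ring.
rewrite E mulr_ge0 ?subr_ge0 ?(ltW ab)//.
by rewrite (le_trans (ler_norm _))// normrM s1 mul1r fg.
Qed.

Lemma increment_eq (a b : R) (f g f' : R -> R) : a <= b ->
  {within `[a, b], continuous f} -> {within `[a, b], continuous g} ->
  (forall x : R, a < x < b -> is_derive x 1 f (f' x)) ->
  (forall x : R, a < x < b -> is_derive x 1 g (f' x)) ->
  f b - f a = g b - g a.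
Proof.
move=> ab cf cg df dg; apply/eqP; rewrite -subr_eq0 -normr_le0.
have -> : f b - f a - (g b - g a) = (f - g) b - (f - g) a.
  by rewrite !fctE; ring.
rewrite -(subrr (0 : R)).
apply: (@norm_increment_le a b (f - g) (cst 0) (fun=> 0) (fun=> 0)) => //.
- by move=> x; apply: cvgB; [exact: cf|exact: cg].
- by apply: continuous_subspaceT => x; exact: cvg_cst.
- move=> x xab; rewrite -(subrr (f' x)).
  by have ? := df x xab; have ? := dg x xab; exact: is_deriveB.
- by move=> x _; rewrite normr0.
Qed.

Lemma eq_intR (a b : R) (f g : R -> R) :
  (forall x, a <= x <= b -> f x = g x) -> intR a b f = intR a b g.
Proof.
move=> fg; apply: eq_Rintegral => x /set_mem /=; rewrite in_itv/=; exact: fg.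
Qed.

Lemma is_derive_expRM (c t : R) :
  is_derive t 1 (fun s => expR (c * s)) (c * expR (c * t)).
Proof.
have dc : is_derive t 1 (fun s : R => c * s) c.
  have -> : (fun s => c * s) = c \*: id by [].
  by apply: is_derive_eq; rewrite [c *: 1]mulr1.
by rewrite mulrC; exact: is_derive1_comp (is_derive_expR (c * t)) dc.
Qed.

(** Comparison with [M * expR (L * x)]: integration gains a factor [1 / L], the source of
    contraction in exponentially weighted norms. *)
Lemma norm_increment_expR_le (L M a b : R) (f f' : R -> R) : a <= b ->
  {within `[a, b], continuous f} ->
  (forall x, a < x < b -> is_derive x 1 f (f' x)) ->
  (forall x, a < x < b -> `|f' x| <= M * (L * expR (L * x))) ->
  `|f b - f a| <= M * (expR (L * b) - expR (L * a)).
Proof.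
move=> ab cf df fM; rewrite mulrBr.
have dg (x : R) : is_derive x 1 (fun t => M * expR (L * t)) (M * (L * expR (L * x))).
  have -> : (fun t => M * expR (L * t)) = M \*: (fun t => expR (L * t)) by [].
  have ? := is_derive_expRM L x.
  exact: is_deriveZ.
apply: (norm_increment_le ab cf _ df) fM => //.
by apply: continuous_subspaceT => x; exact: is_derive_continuous (dg x).
Qed.

Lemma expR_ge1_ge0 (x : R) : 0 <= x -> 1 <= expR x.
Proof. by move=> x0; rewrite -expR0 ler_expR. Qed.

Lemma norm_sinB_le (x y : R) : `|sin x - sin y| <= `|x - y|.
Proof.
wlog yx : x y / y <= x.
  by move=> H; have [/H//|/ltW/H] := leP y x; rewrite distrC [leRHS]distrC.
rewrite [leRHS]ger0_norm ?subr_ge0//.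
apply: (@norm_increment_le y x sin id cos (cst 1) yx) => [||z _] /=.
- by apply: continuous_subspaceT; exact: continuous_sin.
- by apply: continuous_subspaceT => z; exact: cvg_id.
- by rewrite ler_norml cos_geN1 cos_le1.
Qed.

Lemma within_continuous_derive (A : set R) (f f' : R -> R) :
  (forall t, A t -> is_derive t 1 f (f' t)) -> {within A, continuous f}.
Proof.
move=> df; apply: continuous_in_subspaceT => t /set_mem /df.
exact: is_derive_continuous.
Qed.

(** Replacing [f] by [f (max 0 t)] gives a continuous function on the line, so the primitive is
    differentiable from both sides even at 0. *)
Lemma exists_primitive_half_line (f : R -> R) :
  {within `[0, +oo[, continuous f} ->
  exists2 P : R -> R, P 0 = 0 &
    forall t : R, 0 <= t -> is_derive t 1 P (f t) /\ intR 0 t f = P t.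
Proof.
move=> cf.
have cm : continuous (Num.max (0 : R)).
  by move=> x; apply: continuous_max; [exact: cvg_cst | exact: cvg_id].
have rm x : `[0, +oo[%classic (Num.max (0 : R) x).
  by rewrite /= in_itv/= le_max lexx.
have [P dP] := exists_primitive 0 (continuous_retract rm cm cf).
have {}dP (t : R) : 0 <= t -> is_derive t 1 P (f t).
  by move=> t0; have := dP t t0; rewrite /= max_r.
exists (fun t => P t - P 0) => [|t t0]; first by rewrite subrr.
split.
  have -> : (fun t => P t - P 0) = P - cst (P 0) by [].
  have ? := dP _ t0.
  by apply: is_derive_eq; rewrite subr0.
apply: intR_derive => //.
- apply: continuous_subspaceW cf => x /=; rewrite !in_itv/= => /andP[-> //].
- apply: (@within_continuous_derive _ _ f) => x /=; rewrite in_itv/= => /andP[? _].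
  exact: dP.
- by move=> x /andP[/ltW /dP].
Qed.

End Calculus.

(** * Fixed points of contractions in weighted sup norms *)

Section WeightedContraction.
Context {R : realType}.

Lemma exists_expr_lt (c K e : R) : 0 <= c < 1 -> 0 <= K -> 0 < e ->
  exists n, K * c ^+ n < e.
Proof.
move=> /andP[c0 c1] K0 e0.
(* Dividing by [K + 1] rather than [K] covers [K = 0]. *)
have K1 : 0 < K + 1 by rewrite ltr_wpDl.
have /cvgrPdist_lt /(_ (e / (K + 1))) : c ^+ n @[n --> \oo] --> (0 : R).
  by apply: cvg_expr; rewrite ger0_norm.
rewrite divr_gt0// => /(_ isT)[n _ /(_ n (leqnn n))/=].
rewrite sub0r normrN ger0_norm ?exprn_ge0// ltr_pdivlMr// => H.
exists n; apply: le_lt_trans H.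
by rewrite mulrC ler_wpM2l ?exprn_ge0// lerDl.
Qed.

Lemma le0_geometric (c K x : R) : 0 <= c < 1 -> 0 <= K ->
  (forall n, x <= K * c ^+ n) -> x <= 0.
Proof.
move=> c01 K0 xK; apply/ler_addgt0Pr => e /(exists_expr_lt c01 K0)[n /ltW].
by rewrite add0r; exact: le_trans.
Qed.

(** Banach's fixed point theorem with all distances stated pointwise against the weight [g]. Two
    functions need not be at finite weighted distance; it suffices that [u] and [F u] are. It serves
    with [g] exponential on the half line and with [g = 1] on [[0, t0]]. *)
Lemma weighted_contraction_fixpoint (J : Type) (A : set R) (g : R -> R)
    (c D : R) (F : (J -> R -> R) -> J -> R -> R) (u : J -> R -> R) :
  let C (w : J -> R -> R) := forall j, {within A, continuous (w j)} in
  0 <= c < 1 -> 0 <= D ->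
  (forall t, A t -> 0 <= g t) -> {within A, continuous g} ->
  (forall w, C w -> C (F w)) ->
  (forall w1 w2 d, C w1 -> C w2 -> 0 <= d ->
    (forall j t, A t -> `|w1 j t - w2 j t| <= d * g t) ->
    forall j t, A t -> `|F w1 j t - F w2 j t| <= c * d * g t) ->
  C u -> (forall j t, A t -> `|F u j t - u j t| <= D * g t) ->
  exists2 w, C w & forall j t, A t -> F w j t = w j t.
Proof.
move=> C c01 D0 g0 cg CF FL Cu uD.
have /andP[c0 c1] := c01.
pose v n := iter n F u.
have Cv n : C (v n) by elim: n => //= n; exact: CF.
have vS n j t : A t -> `|v n.+1 j t - v n j t| <= c ^+ n * D * g t.
  elim: n j t => [|n IH] j t At; first by rewrite expr0 mul1r uD.
  have := FL _ _ _ (Cv n.+1) (Cv n) _ IH j t At.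
  by rewrite exprS !mulrA; apply; rewrite mulr_ge0// exprn_ge0.
(* The sum of the geometric series [D * c ^+ n]. *)
pose B := D / (1 - c).
have B0 : 0 <= B by rewrite divr_ge0// subr_ge0 ltW.
(* The exact partial sum of the geometric series is kept so that the induction on [k] closes. *)
have vD n k j t : A t ->
    `|v (n + k)%N j t - v n j t| <= B * g t * (c ^+ n - c ^+ (n + k)).
  move=> At; elim: k => [|k IH]; first by rewrite addn0 !subrr normr0 mulr0.
  rewrite addnS (le_trans (ler_distD (v (n + k)%N j t) _ _))//.
  rewrite (le_trans (lerD (vS _ _ _ At) IH))// le_eqVlt; apply/orP; left.
  apply/eqP; rewrite /B exprS; field.
  by rewrite gt_eqF// subr_gt0.
have vB n m j t : A t -> (n <= m)%N -> `|v m j t - v n j t| <= B * g t * c ^+ n.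
  move=> At /subnKC <-; apply: le_trans (vD _ _ _ _ At) _.
  by rewrite ler_wpM2l ?(mulr_ge0 B0 (g0 _ At))// lerBlDr lerDl exprn_ge0.
have vcvg j t : A t -> cvgn (fun n => v n j t).
  move=> At; apply/cauchy_cvgP/cauchy_exP => e e0.
  have [n nB] := exists_expr_lt c01 (mulr_ge0 B0 (g0 _ At)) e0.
  exists (v n j t); exists n => // m nm /=; rewrite /ball/= distrC.
  by apply: le_lt_trans nB; exact: vB.
pose w j t := lim (v n j t @[n --> \oo]).
have vw n j t : A t -> `|w j t - v n j t| <= B * g t * c ^+ n.
  move=> At; apply/ler_addgt0Pr => e e0.
  have /cvgrPdist_lt /(_ e e0) [N _ NB] := vcvg j t At.
  have := NB (maxn n N) (leq_maxr _ _) => /= wv.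
  rewrite (le_trans (ler_distD (v (maxn n N) j t) _ _))// addrC.
  by rewrite lerD ?vB ?leq_maxl// ltW.
have Cw : C w.
  move=> j; apply/subspace_continuousP => t At; apply/cvgrPdist_lt => e e0.
  have e3 : 0 < e / 3 by rewrite divr_gt0.
  (* By continuity [g s < g t + 1] near [t], so convergence to [w] is uniform near [t] and an
     [e / 3] argument gives continuity. *)
  have K0 : 0 <= B * (g t + 1) by rewrite mulr_ge0// addr_ge0// g0.
  have [n nB] := exists_expr_lt c01 K0 e3.
  have cn : 0 <= c ^+ n by rewrite exprn_ge0.
  move/subspace_continuousP : (Cv n j) => /(_ _ At)/cvgrPdist_lt/(_ _ e3) vn.
  move/subspace_continuousP : cg => /(_ _ At)/cvgrPdist_lt/(_ _ ltr01) gn.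
  rewrite near_withinE in vn; rewrite near_withinE in gn.
  rewrite near_withinE; near=> s => As.
  have v1 : `|v n j t - v n j s| < e / 3 by apply: (near vn s).
  have g1 : `|g t - g s| < 1 by apply: (near gn s).
  have v2 : `|w j t - v n j t| < e / 3.
    apply: le_lt_trans (vw n j t At) _; apply: le_lt_trans nB.
    by rewrite ler_wpM2r// ler_wpM2l// lerDl.
  have v3 : `|w j s - v n j s| < e / 3.
    apply: le_lt_trans (vw n j s As) _; apply: le_lt_trans nB.
    rewrite ler_wpM2r// ler_wpM2l//; move: g1; rewrite ltr_norml => /andP[+ _].
    lra.
  move: v1 v2 v3; rewrite !ltr_norml => /andP[? ?] /andP[? ?] /andP[? ?].
  rewrite /from_subspace; apply/andP; split; lra.
exists w => // j t At.
(* Both [F w] and [w] lie within [B * g t * c ^+ n] of the iterate [v n.+1], for every [n]. *)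
apply/eqP; rewrite -subr_eq0 -normr_le0.
apply: (@le0_geometric c (2 * (B * g t))) => // [|n].
  by rewrite mulr_ge0// mulr_ge0// g0.
rewrite (le_trans (ler_distD (v n.+1 j t) _ _))//.
have H1 : `|F w j t - v n.+1 j t| <= B * g t * c ^+ n.
  have H : 0 <= B * c ^+ n by rewrite mulr_ge0// exprn_ge0.
  have := FL w (v n) _ Cw (Cv n) H.
  move=> /(_ _ j t At) /=.
  move=> /(_ _)/le_trans; apply.
    by move=> k s As; rewrite mulrAC vw.
  have -> : c * (B * c ^+ n) * g t = c * (B * g t * c ^+ n) by ring.
  apply: ler_piMl (ltW c1).
  exact: mulr_ge0 (mulr_ge0 B0 (g0 _ At)) (exprn_ge0 _ c0).
have H2 : `|v n.+1 j t - w j t| <= B * g t * c ^+ n.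
  rewrite distrC (le_trans (vw _ _ _ At))// ler_wpM2l ?(mulr_ge0 B0 (g0 _ At))//.
  by rewrite exprS ler_piMl ?exprn_ge0// ltW.
by apply: le_trans (lerD H1 H2) _; rewrite le_eqVlt; apply/orP; left; apply/eqP; ring.
Unshelve. all: by end_near. Qed.
End WeightedContraction.

(** * Globally Lipschitz differential equations *)

Section LipschitzODE.
Context {R : realType} {J : finType} (G : (J -> R) -> J -> R) (K : R).
Hypothesis K0 : 0 <= K.
Hypothesis G_lipschitz : forall (y1 y2 : J -> R) (d : R), 0 <= d ->
  (forall k, `|y1 k - y2 k| <= d) -> forall k, `|G y1 k - G y2 k| <= K * d.

(** Finiteness of [J] gives one neighbourhood on which all components of [y] move by less than
    [e / (K + 1)]. *)
Lemma continuous_lipschitz_comp (A : set R) (y : J -> R -> R) :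
  (forall k, {within A, continuous (y k)}) ->
  forall k, {within A, continuous (fun t => G (y ^~ t) k)}.
Proof.
move=> cy k; apply/subspace_continuousP => t At; apply/cvgrPdist_lt => e e0.
have K1 : 0 < K + 1 by rewrite ltr_wpDl.
have H : \forall s \near within A (nbhs t),
    forall j, `|y j t - y j s| < e / (K + 1).
  apply: filter_forall => j.
  move/subspace_continuousP : (cy j) => /(_ _ At)/cvgrPdist_lt; apply.
  exact: divr_gt0.
near=> s; apply: (@le_lt_trans _ _ (K * (e / (K + 1)))).
  apply: G_lipschitz; first by rewrite divr_ge0// ltW.
  by move=> j; apply: ltW; move: j; near: s.
by rewrite mulrCA gtr_pMr// ltr_pdivrMr// mul1r ltrDl.
Unshelve. all: by end_near. Qed.

(* An inequality |y1 - y2| <= M e^{Lt} with L = 2K + 1 improves itself to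
   |y1 - y2| <= (M / 2) e^{Lt}. *)
Lemma lipschitz_ode_unique (T : R) (y1 y2 : J -> R -> R) :
  (forall k, {within `[0, T], continuous (y1 k)}) ->
  (forall k, {within `[0, T], continuous (y2 k)}) ->
  (forall k (t : R), 0 < t < T -> is_derive t 1 (y1 k) (G (y1 ^~ t) k)) ->
  (forall k (t : R), 0 < t < T -> is_derive t 1 (y2 k) (G (y2 ^~ t) k)) ->
  (forall k, y1 k 0 = y2 k 0) ->
  forall k t, 0 <= t <= T -> y1 k t = y2 k t.
Proof.
move=> c1 c2 d1 d2 y12 k t /andP[t0 tT].
have T0 : 0 <= T by exact: le_trans tT.
pose d j s := y1 j s - y2 j s.
have cd j : {within `[0, T], continuous (d j)}.
  by move=> s; apply: cvgB; [exact: c1|exact: c2].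
have dd j (s : R) : 0 < s < T -> is_derive s 1 (d j) (G (y1 ^~ s) j - G (y2 ^~ s) j).
  move=> sT; have ? := d1 j _ sT; have ? := d2 j _ sT.
  have -> : d j = y1 j - y2 j by [].
  exact: is_deriveB.
have d0 j : d j 0 = 0 by rewrite /d y12 subrr.
(* The starting bound is the sum over the finite [J] of the maxima of the components on the compact
   interval. *)
have [B B0 dB] : exists2 B, 0 <= B &
    forall j s, 0 <= s <= T -> `|d j s| <= B.
  have H j : exists c, forall s, 0 <= s <= T -> `|d j s| <= `|d j c|.
    have [|c _ cmax] := @EVT_max _ (fun s => `|d j s|) 0 T T0.
      by move=> s; apply: cvg_norm; exact: cd.
    by exists c => s sT; apply: cmax; rewrite in_itv.
  have [c cP] := choice H.
  exists (\sum_j `|d j (c j)|) => [|j s sT]; first exact: sumr_ge0.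
  rewrite (bigD1 j)//= (le_trans (cP j s sT))// lerDl.
  exact: sumr_ge0.
pose L := 2 * K + 1.
have L0 : 0 < L by rewrite ltr_wpDl// mulr_ge0.
have dn n j s : 0 <= s <= T -> `|d j s| <= B * 2^-1 ^+ n * expR (L * s).
  elim: n j s => [|n IH] j s sT.
    have /andP[s0 _] := sT.
    rewrite expr0 mulr1 (le_trans (dB _ _ sT))// ler_peMr//.
    by rewrite expR_ge1_ge0// mulr_ge0// ltW.
  have /andP[s0 sT'] := sT.
  have M0 : 0 <= B * 2^-1 ^+ n by rewrite mulr_ge0// exprn_ge0// invr_ge0.
  rewrite -[d j s]subr0 -(d0 j).
  apply: (@le_trans _ _ (B * 2^-1 ^+ n.+1 * (expR (L * s) - expR (L * 0)))).
    apply: norm_increment_expR_le => //.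
    - apply: continuous_subspaceW (cd j) => x /=; rewrite !in_itv/=.
      by move=> /andP[-> /le_trans ->].
    - by move=> x /andP[x0 xs]; apply: dd; rewrite x0 (lt_le_trans xs).
    - move=> x /andP[x0 xs].
      have := @G_lipschitz (y1 ^~ x) (y2 ^~ x) (B * 2^-1 ^+ n * expR (L * x)).
      move=> /(_ _ _ j)/le_trans; apply.
      + by rewrite mulr_ge0// expR_ge0.
      + by move=> i; apply: IH; rewrite ltW//= ltW// (lt_le_trans xs).
      + set M := B * _ in M0 *.
        (* Half of [L] is [K + 2^-1], which exceeds the Lipschitz constant. *)
        have -> : B * 2^-1 ^+ n.+1 * (L * expR (L * x)) =
            (K + 2^-1) * (M * expR (L * x)).
          by rewrite /L /M exprS; field.
        by rewrite ler_wpM2r ?lerDl ?invr_ge0// mulr_ge0// expR_ge0.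
  rewrite ler_wpM2l ?lerBlDr ?lerDl ?expR_ge0//.
  by rewrite mulr_ge0// exprn_ge0// invr_ge0.
apply/eqP; rewrite -subr_eq0 -normr_le0.
apply: (@le0_geometric _ (2^-1) (B * expR (L * t))) => [||n].
- by rewrite invr_ge0 ler0n invf_lt1// ltr1n.
- by rewrite mulr_ge0// expR_ge0.
- by rewrite mulrAC dn// t0.
Qed.

(** The Picard operator has rate 1/2 for the weight [expR (L * t)]: a bound [K * d * expR (L * x)]
    on the derivative integrates to at most [K / L * d * expR (L * t)], and [K <= L / 2]. *)
Lemma lipschitz_ode_exists (y0 : J -> R) :
  exists y : J -> R -> R, (forall k, y k 0 = y0 k) /\
    forall k (t : R), 0 <= t -> is_derive t 1 (y k) (G (y ^~ t) k).
Proof.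
pose A : set R := `[0, +oo[%classic.
have AE t : A t <-> 0 <= t by rewrite /A /= in_itv/= andbT.
pose C (y : J -> R -> R) := forall k, {within A, continuous (y k)}.
have prim y : C y -> exists P : J -> R -> R, forall k, P k 0 = 0 /\
    forall t : R, 0 <= t -> is_derive t 1 (P k) (G (y ^~ t) k) /\
      intR 0 t (fun s => G (y ^~ s) k) = P k t.
  move=> Cy.
  have H k : exists Pk : R -> R, Pk 0 = 0 /\
      forall t : R, 0 <= t -> is_derive t 1 Pk (G (y ^~ t) k) /\
        intR 0 t (fun s => G (y ^~ s) k) = Pk t.
    have [P P0 dP] := exists_primitive_half_line (@continuous_lipschitz_comp A y Cy k).
    by exists P.
  by have [P PP] := choice H; exists P.
pose F (y : J -> R -> R) k t := y0 k + intR 0 t (fun s => G (y ^~ s) k).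
pose L := 2 * K + 1.
have L1 : 1 <= L by rewrite lerDr mulr_ge0.
have L0 : 0 < L by rewrite (lt_le_trans _ L1).
(* Bounds the first Picard step from the constant [y0]: its derivative [G y0 k] is at most [D],
   hence at most [D * (L * expR (L * x))] since [1 <= L]. *)
pose D := \sum_k `|G y0 k|.
have [||||||||w Cw wF] := @weighted_contraction_fixpoint R J A
  (fun t => expR (L * t)) (2^-1) D F (fun k _ => y0 k).
- by rewrite invr_ge0 ler0n invf_lt1// ltr1n.
- exact: sumr_ge0.
- by move=> t _; exact: expR_ge0.
- apply: continuous_subspaceT => x.
  apply: (@continuous_comp _ _ _ ( *%R L)); first exact: mulrl_continuous.
  exact: continuous_expR.
- move=> y /prim[P PP] k.
  apply: (@subspace_eq_continuous _ _ _ (fun t => y0 k + P k t)).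
    by move=> t /set_mem /AE t0; rewrite -((PP k).2 t t0).2.
  apply: (@within_continuous_derive _ _ _ (fun t => G (y ^~ t) k)) => t /AE t0.
  have ? := ((PP k).2 t t0).1.
  have -> : (fun t => y0 k + P k t) = cst (y0 k) + P k by [].
  by apply: is_derive_eq; rewrite add0r.
- move=> v1 v2 d /prim[P1 PP1] /prim[P2 PP2] d0 vd k t /AE t0.
  rewrite /F ((PP1 k).2 t t0).2 ((PP2 k).2 t t0).2 opprD addrACA subrr add0r.
  have -> : P1 k t - P2 k t = (P1 k t - P2 k t) - (P1 k 0 - P2 k 0).
    by rewrite (PP1 k).1 (PP2 k).1 !subrr subr0.
  have dP (x : R) : 0 <= x -> is_derive x 1 (P1 k - P2 k)
      (G (v1 ^~ x) k - G (v2 ^~ x) k).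
    move=> x0; have ? := ((PP1 k).2 x x0).1; have ? := ((PP2 k).2 x x0).1.
    exact: is_deriveB.
  apply: (@le_trans _ _ (2^-1 * d * (expR (L * t) - expR (L * 0)))); last first.
    by rewrite ler_wpM2l ?lerBlDr ?lerDl ?expR_ge0// mulr_ge0// invr_ge0.
  apply: (@norm_increment_expR_le _ _ _ _ _ (P1 k - P2 k)) => //.
  + apply: within_continuous_derive => x /=.
    by rewrite in_itv/= => /andP[x0 _]; exact: dP.
  + by move=> x /andP[/ltW x0 _]; exact: dP.
  + move=> x /andP[/ltW x0 _].
    have := @G_lipschitz (v1 ^~ x) (v2 ^~ x) (d * expR (L * x)).
    move=> /(_ _ _ k)/le_trans; apply.
    * by rewrite mulr_ge0// expR_ge0.
    * by move=> j; apply: vd; exact/AE.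
    * have -> : 2^-1 * d * (L * expR (L * x)) =
          (K + 2^-1) * (d * expR (L * x)) by rewrite /L; field.
      by rewrite ler_wpM2r ?lerDl ?invr_ge0// mulr_ge0// expR_ge0.
- by move=> k; apply: continuous_subspaceT => x; exact: cvg_cst.
- move=> k t /AE t0.
  have [|P PP] := prim (fun k _ => y0 k).
    by move=> j; apply: continuous_subspaceT => x; exact: cvg_cst.
  rewrite /F ((PP k).2 t t0).2 addrAC subrr add0r.
  rewrite -[P k t]subr0 -(PP k).1.
  apply: (@le_trans _ _ (D * (expR (L * t) - expR (L * 0)))); last first.
    by rewrite ler_wpM2l ?lerBlDr ?lerDl ?expR_ge0// sumr_ge0.
  apply: (@norm_increment_expR_le _ _ _ _ _ (P k) (fun=> G y0 k)) => //.
  + apply: within_continuous_derive => x /=.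
    by rewrite in_itv/= => /andP[x0 _]; exact: ((PP k).2 x x0).1.
  + by move=> x /andP[/ltW x0 _]; exact: ((PP k).2 x x0).1.
  + move=> x /andP[/ltW x0 _].
    apply: (@le_trans _ _ D).
      by rewrite /D (bigD1 k)//= lerDl sumr_ge0.
    rewrite ler_peMr ?sumr_ge0//.
    by rewrite (le_trans L1)// ler_peMr ?(ltW L0)// expR_ge1_ge0 ?mulr_ge0// ltW.
have [P PP] := prim w Cw.
have wE k t : 0 <= t -> w k t = y0 k + P k t.
  by move=> t0; rewrite -(wF k t) ?/F ?((PP k).2 t t0).2//; exact/AE.
(* The fixed point [w] is controlled only for [t >= 0]; [y0 + P] agrees with it there and has a
   two-sided derivative at 0 as well. *)
exists (fun k t => y0 k + P k t); split=> [k|k t t0].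
  by rewrite (PP k).1 addr0.
have <- : w ^~ t = (fun j => y0 j + P j t) by apply/funext => j; exact: wE.
have ? := ((PP k).2 t t0).1.
have -> : (fun t => y0 k + P k t) = cst (y0 k) + P k by [].
by apply: is_derive_eq; rewrite add0r.
Qed.

End LipschitzODE.

(** * The Kuramoto flow *)

Section KuramotoFlow.
Context {R : realType} {N : nat} (m kappa : R) (nu : 'I_N -> R).
Hypotheses (m_gt0 : 0 < m) (kappa_gt0 : 0 < kappa).
Implicit Types Th Om : 'I_N -> R -> R.

Definition acceleration (th om : 'I_N -> R) (i : 'I_N) : R :=
  m^-1 * (nu i - om i + kappa / N%:R * \sum_(j < N) sin (th j - th i)).

Lemma norm_mean_le (h : 'I_N -> R) d : 0 <= d -> (forall j, `|h j| <= d) ->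
  `|kappa / N%:R * \sum_(j < N) h j| <= kappa * d.
Proof.
move=> d0 hd; rewrite normrM (ger0_norm (divr_ge0 (ltW kappa_gt0) (ler0n _ _))).
rewrite -mulrA ler_pM2l//.
(* For [N = 0] the factor [N%:R^-1] is 0 by the convention on inverses. *)
have [N0|N0] := posnP N.
  by have -> : N%:R = 0 :> R; [rewrite N0 | rewrite invr0 mul0r].
rewrite mulrC ler_pdivrMr ?ltr0n// (le_trans (ler_norm_sum _ _ _))//.
by rewrite (le_trans (ler_sum _ (fun j _ => hd j)))// sumr_const card_ord mulr_natr.
Qed.

(** A state of the first-order system is indexed by a disjoint sum, phases on the left and
    frequencies on the right, so that the preceding section applies with a finite index type. *)
Definition phases (y : 'I_N + 'I_N -> R) i := y (inl i).
Definition frequencies (y : 'I_N + 'I_N -> R) i := y (inr i).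

Definition kuramoto_field (y : 'I_N + 'I_N -> R) (k : 'I_N + 'I_N) : R :=
  match k with
  | inl i => y (inr i)
  | inr i => acceleration (phases y) (frequencies y) i
  end.

(** The phase equation contributes 1. In the other, damping contributes 1 and coupling [kappa * 2],
    as each phase difference moves by at most [2 * d] and sine is 1-Lipschitz. *)
Lemma kuramoto_field_lipschitz (y1 y2 : 'I_N + 'I_N -> R) (d : R) : 0 <= d ->
  (forall k, `|y1 k - y2 k| <= d) ->
  forall k, `|kuramoto_field y1 k - kuramoto_field y2 k| <=
            (1 + m^-1 * (1 + kappa * 2)) * d.
Proof.
move=> d0 yd; have m0 : 0 <= m^-1 by rewrite invr_ge0 ltW.
case=> i /=.
  rewrite (le_trans (yd (inr i)))// ler_peMl// lerDl mulr_ge0// addr_ge0//.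
  by rewrite mulr_ge0// ltW.
rewrite /acceleration /phases /frequencies -mulrBr normrM (ger0_norm m0).
set s1 := \sum_j _; set s2 := \sum_j _.
have -> : nu i - y1 (inr i) + kappa / N%:R * s1 -
    (nu i - y2 (inr i) + kappa / N%:R * s2) =
    (y2 (inr i) - y1 (inr i)) + kappa / N%:R * (s1 - s2) by ring.
have -> : (1 + m^-1 * (1 + kappa * 2)) * d = d + m^-1 * (d + kappa * (2 * d)).
  by ring.
apply: (@le_trans _ _ (m^-1 * (d + kappa * (2 * d)))); last by rewrite lerDr.
rewrite ler_wpM2l// (le_trans (ler_normD _ _))//.
rewrite lerD//; first by rewrite distrC.
rewrite /s1 /s2 -sumrB; apply: norm_mean_le => [|j]; first by rewrite mulr_ge0.
rewrite (le_trans (norm_sinB_le _ _))//.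
have -> : y1 (inl j) - y1 (inl i) - (y2 (inl j) - y2 (inl i)) =
  (y1 (inl j) - y2 (inl j)) - (y1 (inl i) - y2 (inl i)) by ring.
by rewrite (le_trans (ler_normB _ _))// mulr_natl mulr2n lerD.
Qed.

Let K0 : 0 <= 1 + m^-1 * (1 + kappa * 2).
Proof. by rewrite addr_ge0// mulr_ge0 ?invr_ge0 ?addr_ge0 ?mulr_ge0// ltW. Qed.

Lemma inertial_kuramoto_exists (Th0 Om0 : 'I_N -> R) :
  exists Th Om, inertial_kuramoto_ivp m kappa nu Th0 Om0 Th Om.
Proof.
have [y [y0 dy]] := lipschitz_ode_exists K0 kuramoto_field_lipschitz
  (fun k => match k with inl i => Th0 i | inr i => Om0 i end).
exists (fun i => y (inl i)), (fun i => y (inr i)); split=> [i t t0|i|i].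
- by split; apply: is_derive_within; [exact: dy (inl i) _ _ | exact: dy (inr i) _ _].
- exact: y0 (inl i).
- exact: y0 (inr i).
Qed.

(** Derivatives are required only inside the interval, with continuity up to the ends: global
    solutions restrict to this form, and pairs built from [F] fit it too. *)
Definition kuramoto_on (T : R) Th Om : Prop :=
  [/\ in_CN T Th, in_CN T Om & forall i (t : R), 0 < t < T ->
    is_derive t 1 (Th i) (Om i t) /\
    is_derive t 1 (Om i) (acceleration (Th ^~ t) (Om ^~ t) i)].

Lemma kuramoto_on_unique (T : R) Th1 Om1 Th2 Om2 :
  kuramoto_on T Th1 Om1 -> kuramoto_on T Th2 Om2 ->
  (forall i, Th1 i 0 = Th2 i 0) -> (forall i, Om1 i 0 = Om2 i 0) ->
  agree_on `[0, T] Th1 Th2 /\ agree_on `[0, T] Om1 Om2.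
Proof.
move=> [cT1 cO1 d1] [cT2 cO2 d2] T12 O12.
pose y (Th Om : 'I_N -> R -> R) (k : 'I_N + 'I_N) :=
  match k with inl i => Th i | inr i => Om i end.
have H := lipschitz_ode_unique K0 kuramoto_field_lipschitz
  (T := T) (y1 := y Th1 Om1) (y2 := y Th2 Om2).
have {}H k t : 0 <= t <= T -> y Th1 Om1 k t = y Th2 Om2 k t.
  apply: H => [[]|[]|[] i {}t tT|[] i {}t tT|[]] //=.
  - exact: (d1 i t tT).1.
  - exact: (d1 i t tT).2.
  - exact: (d2 i t tT).1.
  - exact: (d2 i t tT).2.
split=> i t /=; rewrite in_itv/=; [exact: (H (inl i)) | exact: (H (inr i))].
Qed.

Lemma inertial_kuramoto_on (T : R) Th Om :
  inertial_kuramoto m kappa nu Th Om -> kuramoto_on T Th Om.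
Proof.
move=> S.
have c (f f' : R -> R) :
    (forall t, 0 <= t -> has_derivative_within `[0, +oo[ f t (f' t)) ->
    {within `[0, T], continuous f}.
  move=> df; have cf : {within `[0, +oo[, continuous f}.
    apply/subspace_continuousP => t /=; rewrite in_itv/= andbT => /df.
    exact: has_derivative_within_continuous.
  by apply: continuous_subspaceW cf => x /=; rewrite !in_itv/= => /andP[->].
have d (f : R -> R) (t l : R) : 0 < t ->
    has_derivative_within `[0, +oo[ f t l -> is_derive t 1 f l.
  move=> t0; apply: has_derivative_within_is_derive.
  near=> s; rewrite /= in_itv/= andbT ltW//; near: s; exact: lt_nbhsr.
split=> [i|i|i t /andP[t0 _]].
- by apply: c => t t0; exact: (S i t t0).1.
- by apply: c => t t0; exact: (S i t t0).2.
- by have [? ?] := S i t (ltW t0); split; exact: d.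
Unshelve. all: by end_near. Qed.

Lemma inertial_kuramoto_unique Th1 Om1 Th2 Om2 :
  inertial_kuramoto m kappa nu Th1 Om1 -> inertial_kuramoto m kappa nu Th2 Om2 ->
  (forall i, Th1 i 0 = Th2 i 0) -> (forall i, Om1 i 0 = Om2 i 0) ->
  agree_on `[0, +oo[ Th1 Th2 /\ agree_on `[0, +oo[ Om1 Om2.
Proof.
move=> S1 S2 T12 O12.
have H T := kuramoto_on_unique (inertial_kuramoto_on T S1)
  (inertial_kuramoto_on T S2) T12 O12.
split=> i t /=; rewrite in_itv/= andbT => t0.
- by apply: (H t).1; rewrite /= in_itv/= t0 lexx.
- by apply: (H t).2; rewrite /= in_itv/= t0 lexx.
Qed.

(** The integrating factor [expR (m^-1 * s)] cancels the damping, leaving only the difference of the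
    forcing terms. *)
Lemma is_derive_relaxation (h1 h2 t : R) (f1 f2 : R -> R) :
  is_derive t 1 f1 (m^-1 * (h1 - f1 t)) -> is_derive t 1 f2 (m^-1 * (h2 - f2 t)) ->
  is_derive t 1 (fun s => expR (m^-1 * s) * (f1 s - f2 s))
    (m^-1 * expR (m^-1 * t) * (h1 - h2)).
Proof.
move=> d1 d2.
have dE := is_derive_expRM m^-1 t.
have -> : (fun s => expR (m^-1 * s) * (f1 s - f2 s)) =
  (fun s => expR (m^-1 * s)) * (f1 - f2) by [].
apply: is_derive_eq; rewrite /GRing.scale/=.
have -> : (f1 - f2) t = f1 t - f2 t by [].
by ring.
Qed.

End KuramotoFlow.

(** * The map F *)

Section FixedPointMap.
Context {R : realType} {N : nat} (m kappa t0 : R) (nu Om0 Thstar : 'I_N -> R).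
Hypotheses (m_gt0 : 0 < m) (kappa_gt0 : 0 < kappa) (t0_gt0 : 0 < t0).
Implicit Types w Th Om f : 'I_N -> R -> R.

Local Notation F := (FF m kappa t0 nu Om0 Thstar).

(** Clamping the argument to [[0, t0]] makes the derivative two-sided at both endpoints. *)
Lemma in_CN_primitive w : in_CN t0 w -> exists W : 'I_N -> R -> R,
  forall i (t : R), 0 <= t <= t0 -> is_derive t 1 (W i) (w i t).
Proof.
move=> cw.
pose r (x : R) := Num.max 0 (Num.min t0 x).
have cr : continuous r.
  move=> x; apply: continuous_max; first exact: cvg_cst.
  by apply: continuous_min; [exact: cvg_cst | exact: cvg_id].
have rI x : `[0, t0]%classic (r x).
  by rewrite /= in_itv/= le_max lexx ge_max ge_min lexx (ltW t0_gt0).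
have H i : exists P : R -> R, forall t : R, 0 <= t <= t0 -> is_derive t 1 P (w i t).
  have [P dP] := exists_primitive 0 (continuous_retract rI cr (cw i)).
  exists P => t /andP[t_ge0 tt0].
  by have := dP t t_ge0; rewrite /= /r (min_r tt0) max_r.
by have [W dW] := choice H; exists W.
Qed.

(** Turns the integral formula into a differential equation: the phases [Th] come from [w], while
    the damping acts on [f] itself. Later arguments about [F] use this description in place of the
    integrals. *)
Lemma FF_ode w : in_CN t0 w -> exists Th f,
  [/\ forall i (t : R), 0 <= t <= t0 -> is_derive t 1 (Th i) (w i t),
      forall i, Th i t0 = Thstar i,
      forall i, f i 0 = Om0 i,
      forall i (t : R), 0 <= t <= t0 ->
        is_derive t 1 (f i) (acceleration m kappa nu (Th ^~ t) (f ^~ t) i)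
    & agree_on `[0, t0] (F w) f].
Proof.
move=> cw; have [W dW] := in_CN_primitive cw.
pose Th i t := Thstar i - W i t0 + W i t.
have dTh i (t : R) : 0 <= t <= t0 -> is_derive t 1 (Th i) (w i t).
  move=> /(dW i) ?; have -> : Th i = cst (Thstar i - W i t0) + W i by [].
  by apply: is_derive_eq; rewrite add0r.
pose h i l (t : R) := expR (m^-1 * t) * sin (Th l t - Th i t).
have ch i l : {within `[0, t0], continuous (h i l)}.
  apply: continuous_in_subspaceT => x /set_mem /=; rewrite in_itv/= => xt.
  apply: cvgM; first exact: is_derive_continuous (is_derive_expRM _ x).
  apply: (@continuous_comp _ _ _ (fun x => Th l x - Th i x) sin).
    by apply: cvgB; [exact: is_derive_continuous (dTh l _ xt)
                    |exact: is_derive_continuous (dTh i _ xt)].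
  exact: continuous_sin.
have [S dS] : exists S : 'I_N -> 'I_N -> R -> R, forall i l (t : R),
    0 <= t <= t0 -> is_derive t 1 (S i l) (h i l t).
  by have [S dS] := choice (fun i => in_CN_primitive (ch i)); exists S.
(* Variation of constants: [f = nu + expR (- t / m) * Q], with [Q] equal to [Om0 - nu] at time 0. *)
pose Q i t := Om0 i - nu i + kappa / (N%:R * m) * \sum_l (S i l t - S i l 0).
pose f i t := nu i + expR (- m^-1 * t) * Q i t.
exists Th, f; split=> [|i|i|i t tt|i t /=].
- exact: dTh.
- by rewrite /Th subrK.
- rewrite /f /Q mulr0 expR0 mul1r big1 ?mulr0 ?addr0 1?addrC ?subrK// => l _.
  by rewrite subrr.
- have dQ : is_derive t 1 (Q i) (kappa / (N%:R * m) * \sum_l h i l t).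
    have -> : Q i = cst (Om0 i - nu i) +
        (kappa / (N%:R * m)) \*: (\sum_l (S i l - cst (S i l 0))).
      by apply/funext => x; rewrite /Q !fctE/= fct_sumE.
    have ? l : is_derive t 1 (S i l - cst (S i l 0)) (h i l t).
      by have ? := dS i l t tt; apply: is_derive_eq; rewrite subr0.
    by apply: is_derive_eq; rewrite add0r.
  have dE := is_derive_expRM (- m^-1) t.
  have -> : f i = cst (nu i) + (fun t => expR (- m^-1 * t)) * Q i by [].
  have dEQ := is_deriveM dE dQ.
  apply: (is_derive_eq (is_deriveD (is_derive_cst (nu i) t 1) dEQ)).
  rewrite add0r /GRing.scale/= /acceleration /f /h.
  rewrite -mulr_sumr invfM mulNr expRN.
  set E := expR _; have E0 : E != 0 by rewrite gt_eqF// expR_gt0.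
  have -> : \sum_l sin (Th l t - Th i t) = \sum_(j < N) sin (Th j t - Th i t) by [].
  set s := \sum_(j < N) _; set n := N%:R^-1.
  by field; rewrite E0 gt_eqF.
- rewrite in_itv/= => tt; have /andP[t_ge0 tt0] := tt.
  (* Splitting the kernel takes the dependence on [t] out of the integrand and leaves [h], whose
     primitive is [S]. *)
  have EE s : expR (- (t - s) / m) = expR (- m^-1 * t) * expR (m^-1 * s).
    by rewrite -expRD; congr expR; field; rewrite gt_eqF.
  have -> : F w i t = Om0 i * expR (- m^-1 * t) + nu i * (1 - expR (- m^-1 * t)) +
      kappa / (N%:R * m) *
      \sum_l expR (- m^-1 * t) * (S i l t - S i l 0).
    rewrite /FF mulNr [t / m]mulrC -mulNr; congr (_ + _ * _).
    apply: eq_bigr => l _.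
    have -> : expR (- m^-1 * t) * (S i l t - S i l 0) =
      (expR (- m^-1 * t) \*: S i l) t - (expR (- m^-1 * t) \*: S i l) 0.
      by rewrite mulrBr.
    rewrite (@eq_intR _ _ _ _ (fun s => expR (- m^-1 * t) * h i l s)); last first.
      move=> s /andP[s0 st]; rewrite EE -mulrA; congr (_ * (_ * sin _)).
      have st0 : s <= t0 by exact: le_trans tt0.
      (* Once the inner integral is evaluated, the argument of the sine is [Th l s - Th i s]. *)
      have -> : intR s t0 (fun x => w l x - w i x) =
          (W l - W i) t0 - (W l - W i) s.
        apply: intR_derive => //.
        - move=> x; apply: cvgB.
            apply: continuous_subspaceW (cw l) x => x /=; rewrite !in_itv/=.
            by move=> /andP[/(le_trans s0) ->].
          apply: continuous_subspaceW (cw i) x => x /=; rewrite !in_itv/=.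
          by move=> /andP[/(le_trans s0) ->].
        - apply: (@within_continuous_derive _ _ _ (fun t => w l t - w i t)) => x /=.
          rewrite in_itv/= => /andP[sx xt0].
          have xx : 0 <= x <= t0 by rewrite (le_trans s0).
          by have ? := dW l x xx; have ? := dW i x xx; exact: is_deriveB.
        - move=> x /andP[sx xt0].
          have xx : 0 <= x <= t0 by rewrite (le_trans s0) ltW.
          by have ? := dW l x xx; have ? := dW i x xx; exact: is_deriveB.
      by rewrite /Th !fctE; ring.
    have htt0 : {within `[0, t], continuous (h i l)}.
      apply: continuous_subspaceW (ch i l) => x /=; rewrite !in_itv/=.
      by move=> /andP[-> /le_trans ->].
    have d (x : R) : 0 <= x <= t -> is_derive x 1 (expR (- m^-1 * t) \*: S i l)
        (expR (- m^-1 * t) * h i l x).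
      move=> /andP[x0 xt]; have xx : 0 <= x <= t0 by rewrite x0 (le_trans xt).
      by have ? := dS i l x xx; exact: is_deriveZ.
    apply: intR_derive t_ge0 _ _ _.
    - by move=> x; apply: cvgMr; exact: htt0.
    - exact: (within_continuous_derive d).
    - by move=> x /andP[/ltW x0 /ltW xt]; apply: d; rewrite x0.
  by rewrite -mulr_sumr /f /Q; ring.
Qed.

Lemma FF_continuous w : in_CN t0 w -> in_CN t0 (F w).
Proof.
move=> /FF_ode[Th [f [_ _ _ df Ff]]] i.
apply: (@subspace_eq_continuous _ _ _ (f i)).
  by move=> t /set_mem tt; rewrite -Ff.
apply: within_continuous_derive => t /=; rewrite in_itv/=; exact: df.
Qed.

(** Kept pointwise with a free [D], so that it yields both the sup norm estimate and the hypothesis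
    of the contraction principle. *)
Lemma FF_dist_le w1 w2 (D t : R) : in_CN t0 w1 -> in_CN t0 w2 -> 0 <= D ->
  (forall i s, 0 <= s <= t0 -> `|w1 i s - w2 i s| <= D) ->
  0 <= t <= t0 -> forall i,
  `|F w1 i t - F w2 i t| <= Num.min (2 * kappa * t0) (kappa * t0 ^+ 2 / m) * D.
Proof.
move=> c1 c2 D0 wD tt i; have /andP[t_ge0 tt0] := tt.
have [Th1 [f1 [dT1 T1 f10 df1 ->]]] := FF_ode c1; last by rewrite /= in_itv.
have [Th2 [f2 [dT2 T2 f20 df2 ->]]] := FF_ode c2; last by rewrite /= in_itv.
(* The two phase vectors coincide at [t0], so their difference is integrated backwards from
   there. *)
have dTh j (s : R) : 0 <= s <= t0 -> `|Th1 j s - Th2 j s| <= D * (t0 - s).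
  move=> /andP[s0 st0].
  have dT (x : R) : s <= x <= t0 -> is_derive x 1 (Th1 j - Th2 j) (w1 j x - w2 j x).
    move=> /andP[sx xt0]; have xx : 0 <= x <= t0 by rewrite (le_trans s0).
    by have ? := dT1 j x xx; have ? := dT2 j x xx; exact: is_deriveB.
  have dD (x : R) : is_derive x 1 (D \*: id) D.
    by apply: is_derive_eq; rewrite [D *: 1]mulr1.
  have -> : D * (t0 - s) = (D \*: id) t0 - (D \*: id) s by rewrite mulrBr.
  have -> : Th1 j s - Th2 j s = - ((Th1 j - Th2 j) t0 - (Th1 j - Th2 j) s).
    by rewrite !fctE T1 T2 subrr sub0r opprK.
  rewrite normrN.
  apply: (@norm_increment_le _ s t0 _ _ (fun x => w1 j x - w2 j x) (cst D)) => //.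
  - apply: within_continuous_derive => x /=; rewrite in_itv/=; exact: dT.
  - by apply: continuous_subspaceT => x; exact: is_derive_continuous (dD x).
  - by move=> x /andP[/ltW sx /ltW xt0]; apply: dT; rewrite sx.
  - by move=> x /andP[sx xt0]; apply: wD; rewrite (le_trans s0) ltW.
pose S Th s := kappa / N%:R * \sum_(j < N) sin (Th j s - Th i s).
have dS s : 0 <= s <= t0 -> `|S Th1 s - S Th2 s| <= kappa * (2 * (D * (t0 - s))).
  move=> ss; rewrite /S -mulrBr -sumrB.
  have D' : 0 <= D * (t0 - s).
    by have /andP[_ ?] := ss; rewrite mulr_ge0// subr_ge0.
  apply: norm_mean_le => // [|j]; first by rewrite mulr_ge0.
  rewrite (le_trans (norm_sinB_le _ _))//.
  have -> : Th1 j s - Th1 i s - (Th2 j s - Th2 i s) =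
    (Th1 j s - Th2 j s) - (Th1 i s - Th2 i s) by ring.
  by rewrite (le_trans (ler_normB _ _))// mulr_natl mulr2n lerD ?dTh.
pose e s := expR (m^-1 * s) * (f1 i s - f2 i s).
have de (s : R) : 0 <= s <= t0 -> is_derive s 1 e
    (m^-1 * expR (m^-1 * s) * (S Th1 s - S Th2 s)).
  move=> ss.
  have -> : S Th1 s - S Th2 s = (nu i + S Th1 s) - (nu i + S Th2 s) by ring.
  apply: (@is_derive_relaxation _ m _ _ s (f1 i) (f2 i)).
  - by have := df1 i s ss; rewrite /acceleration [nu i - _ + _]addrAC.
  - by have := df2 i s ss; rewrite /acceleration [nu i - _ + _]addrAC.
have ce : {within `[0, t], continuous e}.
  apply: within_continuous_derive => x /=; rewrite in_itv/= => /andP[x0 xt].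
  by apply: de; rewrite x0 (le_trans xt).
have e0 : e 0 = 0 by rewrite /e f10 f20 subrr mulr0.
have -> : f1 i t - f2 i t = expR (- (m^-1 * t)) * (e t - e 0).
  by rewrite e0 subr0 /e mulrA -expRD addNr expR0 mul1r.
rewrite normrM (ger0_norm (expR_ge0 _)) expRN mulrC.
rewrite ler_pdivrMr ?expR_gt0//.
have m0 : 0 <= m^-1 by rewrite invr_ge0 ltW.
have bound s : 0 < s < t -> `|m^-1 * expR (m^-1 * s) * (S Th1 s - S Th2 s)| <=
    m^-1 * expR (m^-1 * s) * (kappa * (2 * (D * (t0 - s)))).
  move=> /andP[s0 st]; rewrite normrM ger0_norm ?mulr_ge0 ?expR_ge0//.
  rewrite ler_wpM2l ?mulr_ge0 ?expR_ge0// dS//.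
  by rewrite (ltW s0) (le_trans (ltW st)).
have dee s : 0 < s < t -> is_derive s 1 e
    (m^-1 * expR (m^-1 * s) * (S Th1 s - S Th2 s)).
  by move=> /andP[s0 st]; apply: de; rewrite (ltW s0) (le_trans (ltW st)).
rewrite /Num.min; case: ifP => _.
(* Here [t0 - s] is bounded by [t0], and [m^-1 * expR (m^-1 * s)] integrates to at most
   [expR (m^-1 * t)]. *)
- apply: (@le_trans _ _ (2 * kappa * t0 * D *
      (expR (m^-1 * t) - expR (m^-1 * 0)))); last first.
    by rewrite ler_wpM2l ?lerBlDr ?lerDl ?expR_ge0// !mulr_ge0// ltW.
  apply: (norm_increment_expR_le t_ge0 ce dee) => s ss.
  rewrite (le_trans (bound s ss))// [leRHS]mulrC ler_wpM2l ?mulr_ge0 ?expR_ge0//.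
  have -> : 2 * kappa * t0 * D = kappa * (2 * (D * t0)) by ring.
  rewrite ler_pM2l// ler_pM2l// ler_wpM2l// lerBlDr lerDl.
  by have /andP[/ltW] := ss.
(* Here [expR (m^-1 * s)] is bounded by its value at [t]; [H] is a primitive of the remaining linear
   bound, with [H t <= 0] and [- H 0 = c * t0 ^+ 2]. *)
- pose c := expR (m^-1 * t) * m^-1 * kappa * D.
  pose H (s : R) := - (c * (t0 - s) ^+ 2).
  have dH (s : R) : is_derive s 1 H (2 * c * (t0 - s)).
    have -> : H = - (c \*: (cst t0 - id) ^+ 2) by [].
    apply: is_derive_eq; rewrite /GRing.scale /= !fctE; ring.
  have c0 : 0 <= c by rewrite !mulr_ge0 ?expR_ge0// ltW.
  apply: (@le_trans _ _ (H t - H 0)).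
    apply: (norm_increment_le t_ge0 ce _ dee (fun s _ => dH s)) => [|s ss].
      by apply: continuous_subspaceT => x; exact: is_derive_continuous (dH x).
    rewrite (le_trans (bound s ss))//.
    have /andP[s0 st] := ss.
    have -> : 2 * c * (t0 - s) =
        m^-1 * expR (m^-1 * t) * (kappa * (2 * (D * (t0 - s)))).
      by rewrite /c; ring.
    rewrite ler_wpM2r//.
      by rewrite !mulr_ge0 ?subr_ge0 ?(ltW kappa_gt0)// (le_trans (ltW st)).
    by rewrite ler_wpM2l// ler_expR ler_wpM2l// ltW.
  have -> : kappa * t0 ^+ 2 / m * D * expR (m^-1 * t) = - H 0.
    by rewrite /H /c; ring.
  by rewrite gerDr oppr_le0 mulr_ge0// sqr_ge0.
Qed.

End FixedPointMap.

(** * The sup norm on the space of continuous frequency vectors *)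

Section SupNorm.
Context {R : realType} {N : nat} (t0 : R).
Hypothesis t0_gt0 : 0 < t0.
Implicit Types w : 'I_N -> R -> R.

(** Continuity on the compact interval bounds the set of values, without which its supremum would
    not be an upper bound. *)
Lemma le_CN_norm w i t : in_CN t0 w -> 0 <= t <= t0 -> `|w i t| <= CN_norm t0 w.
Proof.
move=> cw tt; apply: le_trans (le_bigmax _ _ i); apply: ub_le_sup; last first.
  by exists t => //=; rewrite in_itv.
have [|c _ cmax] := @EVT_max _ (fun s => `|w i s|) 0 t0 (ltW t0_gt0).
  by move=> s; apply: cvg_norm; exact: cw.
by exists `|w i c| => _ [s /= ss <-]; exact: cmax.
Qed.

Lemma CN_norm_le w D : 0 <= D ->
  (forall i t, 0 <= t <= t0 -> `|w i t| <= D) -> CN_norm t0 w <= D.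
Proof.
move=> D0 wD; apply: bigmax_le => // i _; apply: ge_sup.
  by exists `|w i 0|, 0 => //=; rewrite in_itv/= lexx ltW.
by move=> _ [t /= tt <-]; apply: wD; rewrite in_itv in tt.
Qed.

Lemma CN_norm_ge0 w : 0 <= CN_norm t0 w.
Proof. exact: bigmax_ge_id. Qed.

Lemma in_CNB w1 w2 : in_CN t0 w1 -> in_CN t0 w2 ->
  in_CN t0 (fun i t => w1 i t - w2 i t).
Proof. by move=> c1 c2 i t; apply: cvgB; [exact: c1|exact: c2]. Qed.

End SupNorm.

(** * Solutions and fixed points *)

Section Solutions.
Context {R : realType} {N : nat} (m kappa t0 : R) (nu Om0 Thstar : 'I_N -> R).
Hypotheses (m_gt0 : 0 < m) (kappa_gt0 : 0 < kappa) (t0_gt0 : 0 < t0).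
Implicit Types w Th Om f : 'I_N -> R -> R.

Local Notation F := (FF m kappa t0 nu Om0 Thstar).

Lemma in_CN_segment (a b : R) w i : 0 <= a -> b <= t0 -> in_CN t0 w ->
  {within `[a, b], continuous (w i)}.
Proof.
move=> a0 bt0 cw; apply: continuous_subspaceW (cw i) => x /=; rewrite !in_itv/=.
by move=> /andP[/(le_trans a0) -> /le_trans ->].
Qed.

Lemma agree_on_phases Th1 Th2 Om : in_CN t0 Th1 -> in_CN t0 Th2 ->
  (forall i (t : R), 0 < t < t0 -> is_derive t 1 (Th1 i) (Om i t)) ->
  (forall i (t : R), 0 < t < t0 -> is_derive t 1 (Th2 i) (Om i t)) ->
  (forall i, Th1 i t0 = Th2 i t0) -> agree_on `[0, t0] Th1 Th2.
Proof.
move=> cT1 cT2 d1 d2 T12 i t /=; rewrite in_itv/= => /andP[t_ge0 tt0].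
have := @increment_eq _ t t0 (Th1 i) (Th2 i) (Om i) tt0.
rewrite T12 => H; apply: oppr_inj; apply: (addrI (Th2 i t0)); apply: H.
- exact: in_CN_segment.
- exact: in_CN_segment.
- by move=> x /andP[/(le_lt_trans t_ge0) x0 xt0]; apply: d1; rewrite x0.
- by move=> x /andP[/(le_lt_trans t_ge0) x0 xt0]; apply: d2; rewrite x0.
Qed.

(** The phases rebuilt from [w] are those of the solution, having the same derivative and the same
    value at [t0]. Then [Om] and [f] relax under the same forcing from the same initial value, so
    they coincide. *)
Lemma solution_FF_fixed Th Om w : inertial_kuramoto m kappa nu Th Om ->
  (forall i, Th i t0 = Thstar i) -> (forall i, Om i 0 = Om0 i) ->
  in_CN t0 w -> agree_on `[0, t0] Om w -> agree_on `[0, t0] (F w) w.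
Proof.
move=> /(inertial_kuramoto_on t0)[cT cO dTO] T0 O0 cw Ow.
have [Th1 [f [dTh1 T1 f0 df Ff]]] := FF_ode kappa nu Om0 Thstar m_gt0 t0_gt0 cw.
have cTh1 : in_CN t0 Th1.
  by move=> i; apply: within_continuous_derive => x /=; rewrite in_itv/=; exact: dTh1.
have cf : in_CN t0 f.
  by move=> i; apply: within_continuous_derive => x /=; rewrite in_itv/=; exact: df.
have TT : agree_on `[0, t0] Th Th1.
  apply: (@agree_on_phases _ _ Om) => // [j x xt|j x /andP[/ltW x0 /ltW xt]|j].
  - exact: (dTO j x xt).1.
  - have xx : 0 <= x <= t0 by rewrite x0.
    by rewrite Ow ?in_itv//=; exact: dTh1.
  - by rewrite T0 T1.
move=> i t tt; rewrite Ff// -Ow//.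
move: tt; rewrite /= in_itv/= => /andP[t_ge0 tt0].
pose e s := expR (m^-1 * s) * (Om i s - f i s).
have e0 : e 0 = 0 by rewrite /e O0 f0 subrr mulr0.
have : e t = 0.
  pose z : R -> R := cst 0.
  suff : e t - e 0 = z t - z 0 by rewrite e0 subr0 subrr.
  apply: (@increment_eq _ 0 t e z (fun=> 0)) => //.
  - move=> x; apply: cvgM.
      apply: continuous_subspaceT x => x.
      exact: is_derive_continuous (is_derive_expRM _ x).
    by apply: cvgB; apply: in_CN_segment x.
  - by apply: continuous_subspaceT => x; exact: cvg_cst.
  - move=> x /andP[x0 xt].
    have xt0 : x < t0 by exact: lt_le_trans tt0.
    have xx : 0 <= x <= t0 by rewrite !ltW.
    pose h := nu i + kappa / N%:R * \sum_(j < N) sin (Th j x - Th i x).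
    have -> : 0 = m^-1 * expR (m^-1 * x) * (h - h) by rewrite subrr mulr0.
    apply: (@is_derive_relaxation _ m _ _ x (Om i) (f i)).
    + have xx' : 0 < x < t0 by rewrite x0.
      by have := (dTO i x xx').2; rewrite /acceleration [nu i - _ + _]addrAC.
    + have := df i x xx; rewrite /acceleration [nu i - _ + _]addrAC /h.
      by under [X in kappa / N%:R * X]eq_bigr do rewrite -!TT ?in_itv//.
move/eqP; rewrite mulf_eq0 gt_eqF ?expR_gt0//= subr_eq0 => /eqP ->.
by [].
Qed.

(** The global solution starts from the rebuilt phases at time 0; local uniqueness then carries the
    condition at [t0] over to it. *)
Lemma FF_fixed_solution w : in_CN t0 w -> agree_on `[0, t0] (F w) w ->
  exists Th Om, [/\ inertial_kuramoto m kappa nu Th Om,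
    forall i, Th i t0 = Thstar i, forall i, Om i 0 = Om0 i
    & agree_on `[0, t0] Om w].
Proof.
move=> cw Fw.
have [Th1 [f [dTh1 T1 f0 df Ff]]] := FF_ode kappa nu Om0 Thstar m_gt0 t0_gt0 cw.
have fw i t : 0 <= t <= t0 -> f i t = w i t.
  by move=> tt; rewrite -Ff ?Fw//= in_itv.
have K1 : kuramoto_on m kappa nu t0 Th1 f.
  split=> [i|i|i t /andP[t_gt0 tt0]].
  - by apply: within_continuous_derive => x /=; rewrite in_itv/=; exact: dTh1.
  - by apply: within_continuous_derive => x /=; rewrite in_itv/=; exact: df.
  - have tt : 0 <= t <= t0 by rewrite !ltW.
    by split; [rewrite fw//; exact: dTh1 | exact: df].
have [Th [Om [S T0 O0]]] :=
  inertial_kuramoto_exists nu m_gt0 kappa_gt0 (Th1 ^~ 0) Om0.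
have [TT OO] := kuramoto_on_unique m_gt0 kappa_gt0
  (inertial_kuramoto_on t0 S) K1 T0 (fun i => etrans (O0 i) (esym (f0 i))).
exists Th, Om; split=> // [i|i t tt].
- by rewrite TT//= in_itv/= lexx ltW.
- by rewrite OO// fw//; move: tt; rewrite /= in_itv.
Qed.

(** Equal frequencies carry the equality of phases from [t0] back to 0, where forward uniqueness
    takes over. *)
Lemma inertial_kuramoto_terminal_unique Th1 Om1 Th2 Om2 :
  inertial_kuramoto m kappa nu Th1 Om1 -> inertial_kuramoto m kappa nu Th2 Om2 ->
  (forall i, Th1 i t0 = Th2 i t0) -> agree_on `[0, t0] Om1 Om2 ->
  agree_on `[0, +oo[ Th1 Th2 /\ agree_on `[0, +oo[ Om1 Om2.
Proof.
move=> S1 S2 T12 O12.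
have [cT1 _ d1] := inertial_kuramoto_on t0 S1.
have [cT2 _ d2] := inertial_kuramoto_on t0 S2.
have TT : agree_on `[0, t0] Th1 Th2.
  apply: (@agree_on_phases _ _ Om1) => // i t tt; first exact: (d1 i t tt).1.
  rewrite O12; first exact: (d2 i t tt).1.
  by have /andP[/ltW t_ge0 /ltW tt0] := tt; rewrite /= in_itv/= t_ge0.
apply: (inertial_kuramoto_unique m_gt0 kappa_gt0 S1 S2) => i.
- by apply: TT; rewrite /= in_itv/= lexx ltW.
- by apply: O12; rewrite /= in_itv/= lexx ltW.
Qed.

Lemma phase_intR Th Om : inertial_kuramoto m kappa nu Th Om ->
  forall i t, 0 <= t <= t0 -> Th i t = Th i t0 - intR t t0 (Om i).
Proof.
move=> /(inertial_kuramoto_on t0)[cT cO d] i t /andP[t_ge0 tt0].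
suff -> : intR t t0 (Om i) = Th i t0 - Th i t by rewrite opprB addrC subrK.
apply: intR_derive tt0 _ _ _.
- exact: in_CN_segment.
- exact: in_CN_segment.
- by move=> x /andP[/(le_lt_trans t_ge0) x0 xt0]; apply: (d i x _).1; rewrite x0.
Qed.

Let c := Num.min (2 * kappa * t0) (kappa * t0 ^+ 2 / m).

Lemma contraction_rate_ge0 : 0 <= c.
Proof.
have ? := ltW kappa_gt0; have ? := ltW t0_gt0; have ? := ltW m_gt0.
by rewrite le_min !mulr_ge0 ?invr_ge0 ?exprn_ge0.
Qed.

Lemma contraction_rate_lt1 :
  t0 < Num.max (1 / (2 * kappa)) (Num.sqrt (m / kappa)) -> c < 1.
Proof.
(* Each alternative in the maximum makes the matching entry of the minimum less than 1. *)
rewrite lt_max gt_min => /orP[H|H]; apply/orP; [left|right].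
  by rewrite mulrC; move: H; rewrite ltr_pdivlMr// mulr_gt0.
have H2 : t0 ^+ 2 < m / kappa.
  rewrite -[ltRHS]sqr_sqrtr ?divr_ge0 ?ltW//.
  by rewrite ltr_pXn2r// nnegrE ?sqrtr_ge0// ltW.
by rewrite ltr_pdivrMr// mul1r mulrC -ltr_pdivlMr.
Qed.

Lemma CN_dist_FF_le w1 w2 : in_CN t0 w1 -> in_CN t0 w2 ->
  CN_dist t0 (F w1) (F w2) <= c * CN_dist t0 w1 w2.
Proof.
move=> c1 c2; apply: CN_norm_le => // [|i t tt].
  by rewrite mulr_ge0 ?contraction_rate_ge0// CN_norm_ge0.
apply: (FF_dist_le nu Om0 Thstar m_gt0 kappa_gt0 t0_gt0 c1 c2) => //.
  exact: CN_norm_ge0.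
move=> j s ss.
by apply: (@le_CN_norm _ _ t0 t0_gt0 (fun i t => w1 i t - w2 i t));
  [exact: in_CNB|].
Qed.

Lemma CN_dist_iter_FF w Om n : in_CN t0 w -> in_CN t0 Om ->
  agree_on `[0, t0] (F Om) Om ->
  CN_dist t0 (iter n F w) Om <= CN_dist t0 w Om * c ^+ n.
Proof.
move=> cw cOm FOm.
have cn k : in_CN t0 (iter k F w).
  by elim: k => //= k; exact: FF_continuous.
elim: n => [|n IH]; first by rewrite expr0 mulr1.
(* [F Om] and [Om] agree only on [[0, t0]], so the replacement is made inside the sets whose suprema
   are taken. *)
have -> : CN_dist t0 (iter n.+1 F w) Om = CN_dist t0 (F (iter n F w)) (F Om).
  rewrite /CN_dist /CN_norm; apply: eq_bigr => i _; congr sup.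
  by apply/seteqP; split=> _ [t tt <-]; exists t => //=; rewrite FOm.
rewrite (le_trans (CN_dist_FF_le (cn n) cOm))// exprS mulrCA.
by rewrite ler_wpM2l ?contraction_rate_ge0.
Qed.

Lemma FF_fixed_exists : c < 1 ->
  exists2 w, in_CN t0 w & agree_on `[0, t0] (F w) w.
Proof.
move=> c1; pose u : 'I_N -> R -> R := fun _ _ => 0.
have cu : in_CN t0 u by move=> i; apply: continuous_subspaceT => x; exact: cvg_cst.
apply: (@weighted_contraction_fixpoint R 'I_N `[0, t0]%classic (cst 1) c
  (CN_dist t0 (F u) u) F u) => //.
- by rewrite contraction_rate_ge0.
- exact: CN_norm_ge0.
- by apply: continuous_subspaceT => x; exact: cvg_cst.
- by move=> w; exact: FF_continuous.
- move=> w1 w2 d c1' c2 d0 wd j t /=; rewrite in_itv/= mulr1 => tt.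
  apply: (FF_dist_le nu Om0 Thstar m_gt0 kappa_gt0 t0_gt0 c1' c2 d0) => // i s ss.
  by have := wd i s; rewrite /= mulr1; apply; rewrite in_itv.
- move=> j t /=; rewrite in_itv/= mulr1 => tt.
  apply: (@le_CN_norm _ _ t0 t0_gt0 (fun i t => F u i t - u i t)) => //.
  by apply: in_CNB => //; exact: FF_continuous.
Qed.

Lemma FF_fixed_unique w1 w2 : c < 1 -> in_CN t0 w1 -> in_CN t0 w2 ->
  agree_on `[0, t0] (F w1) w1 -> agree_on `[0, t0] (F w2) w2 ->
  agree_on `[0, t0] w1 w2.
Proof.
move=> c1 cw1 cw2 F1 F2 i t; rewrite /= in_itv/= => tt.
(* Applying [F] leaves the distance unchanged yet shrinks it by [c], so it is below every term of a
   null geometric sequence. *)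
have H : forall n, CN_dist t0 w1 w2 <= CN_dist t0 w1 w2 * c ^+ n.
  elim=> [|n IH]; first by rewrite expr0 mulr1.
  have E : CN_dist t0 w1 w2 = CN_dist t0 (F w1) (F w2).
    rewrite /CN_dist /CN_norm; apply: eq_bigr => j _; congr sup.
    by apply/seteqP; split=> _ [s ss <-]; exists s => //=; rewrite F1 ?F2.
  rewrite {1}E (le_trans (CN_dist_FF_le cw1 cw2))// exprS mulrCA.
  by rewrite ler_wpM2l ?contraction_rate_ge0.
have D0 : CN_dist t0 w1 w2 <= 0.
  by apply: (@le0_geometric _ c) H => //; [rewrite contraction_rate_ge0|exact: CN_norm_ge0].
apply/eqP; rewrite -subr_eq0 -normr_le0 (le_trans _ D0)//.
by apply: (@le_CN_norm _ _ t0 t0_gt0 (fun i t => w1 i t - w2 i t));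
  [exact: in_CNB|].
Qed.

End Solutions.

Theorem proposition5p1 (R : realType) (N : nat) (kappa m t0 : R)
    (nu Om0 Thstar : 'I_N -> R)
    (hN : (1 <= N)%N) (hkappa : 0 < kappa) (hm : 0 < m) (ht0 : 0 < t0) :
  let F := FF m kappa t0 nu Om0 Thstar in
  [/\ (* F maps C[0, t0]^N to itself *)
      forall w, in_CN t0 w -> in_CN t0 (F w),
      (* (1) *)
      forall w, in_CN t0 w ->
        let sol Th Om :=
          exists Th0 : 'I_N -> R,
            [/\ inertial_kuramoto_ivp m kappa nu Th0 Om0 Th Om,
                forall i, Th i t0 = Thstar i
              & agree_on `[0, t0] Om w] in
        ((exists Th Om, sol Th Om) <-> agree_on `[0, t0] (F w) w) /\
        (forall Th Om Th' Om', sol Th Om -> sol Th' Om' ->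
           agree_on `[0, +oo[ Th Th' /\ agree_on `[0, +oo[ Om Om'),
      (* (2) *)
      forall w1 w2, in_CN t0 w1 -> in_CN t0 w2 ->
        CN_dist t0 (F w1) (F w2)
          <= Num.min (2 * kappa * t0) (kappa * t0 ^+ 2 / m) * CN_dist t0 w1 w2
    & (* (3) *)
      t0 < Num.max (1 / (2 * kappa)) (Num.sqrt (m / kappa)) ->
      exists Th Om : 'I_N -> R -> R,
        [/\ [/\ inertial_kuramoto m kappa nu Th Om,
                forall i, Th i t0 = Thstar i
              & forall i, Om i 0 = Om0 i],
            forall Th' Om' : 'I_N -> R -> R,
              inertial_kuramoto m kappa nu Th' Om' ->
              (forall i, Th' i t0 = Thstar i) ->
              (forall i, Om' i 0 = Om0 i) ->
              agree_on `[0, +oo[ Th' Th /\ agree_on `[0, +oo[ Om' Om,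
            forall w, in_CN t0 w ->
              CN_dist t0 (iter n F w) Om @[n --> \oo] --> (0 : R),
            forall i t, 0 <= t <= t0 ->
              Th i t = Thstar i - intR t t0 (Om i)
          & let Th0 := fun i => Th i 0 in
            inertial_kuramoto_ivp m kappa nu Th0 Om0 Th Om /\
            (forall Th' Om' : 'I_N -> R -> R,
               inertial_kuramoto_ivp m kappa nu Th0 Om0 Th' Om' ->
               agree_on `[0, +oo[ Th' Th /\ agree_on `[0, +oo[ Om' Om)]].
Proof.
move=> F.
have solP Th Om w : in_CN t0 w -> inertial_kuramoto m kappa nu Th Om ->
    (forall i, Th i t0 = Thstar i) -> (forall i, Om i 0 = Om0 i) ->
    agree_on `[0, t0] Om w -> agree_on `[0, t0] (F w) w.
  by move=> cw S T0 O0 Ow; exact: (solution_FF_fixed hm ht0 S T0 O0 cw Ow).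
split.
- by move=> w; exact: FF_continuous.
- move=> w cw sol; split; first split.
  + by move=> [Th [Om [Th0 [[S _ O0] T0 Ow]]]]; exact: solP S T0 O0 Ow.
  + move=> /(FF_fixed_solution hm hkappa ht0 cw)[Th [Om [S T0 O0 Ow]]].
    by exists Th, Om, (Th ^~ 0); split.
  + move=> Th Om Th' Om' [_ [[S _ _] T0 Ow]] [_ [[S' _ _] T0' Ow']].
    apply: (inertial_kuramoto_terminal_unique hm hkappa ht0 S S') => [i|i t tt].
      by rewrite T0 T0'.
    by rewrite Ow// Ow'.
- by move=> w1 w2; exact: CN_dist_FF_le.
- move=> /(contraction_rate_lt1 hm hkappa ht0) c_lt1.
  have [w cw Fw] := FF_fixed_exists nu Om0 Thstar hm hkappa ht0 c_lt1.
  have [Th [Om [S T0 O0 Ow]]] := FF_fixed_solution hm hkappa ht0 cw Fw.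
  have [_ cO _] := inertial_kuramoto_on t0 S.
  have FO : agree_on `[0, t0] (F Om) Om by apply: solP S T0 O0 _.
  exists Th, Om; split=> //.
  (* The frequencies of any competitor form another fixed point, hence equal [Om] on [[0, t0]];
     terminal uniqueness extends this to the half line. *)
  + move=> Th' Om' S' T0' O0'.
    have [_ cO' _] := inertial_kuramoto_on t0 S'.
    have FO' : agree_on `[0, t0] (F Om') Om' by apply: solP S' T0' O0' _.
    apply: (inertial_kuramoto_terminal_unique hm hkappa ht0 S' S) => [i|].
      by rewrite T0 T0'.
    exact: (FF_fixed_unique hm hkappa ht0 c_lt1 cO' cO FO' FO).
  (* The distance to [Om] is nonnegative and dominated by [CN_dist t0 v Om * c ^+ n], which tends to
     0. *)
  + move=> v cv; apply/cvgrPdist_lt => e e0.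
    have c_ge0 := contraction_rate_ge0 hm hkappa ht0.
    set c := Num.min _ _ in c_lt1 c_ge0.
    have : CN_dist t0 v Om * c ^+ n @[n --> \oo] --> CN_dist t0 v Om * 0.
      by apply: cvgMr; apply: cvg_expr; rewrite ger0_norm.
    rewrite mulr0 => /cvgrPdist_lt/(_ e e0); apply: filterS => n /=.
    rewrite !sub0r !normrN [X in _ -> X < _]ger0_norm ?CN_norm_ge0//.
    apply: le_lt_trans; rewrite (le_trans _ (ler_norm _))//.
    exact: (CN_dist_iter_FF hm hkappa ht0 n cv cO FO).
  + by move=> i t tt; rewrite -T0; exact: (phase_intR S).
  + split=> [|Th' Om' [S' T0' O0']]; first by split.
    apply: (inertial_kuramoto_unique hm hkappa S' S) => // i.
    by rewrite O0' O0.
Qed.
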